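(* Let $|\Psi^{RQ_1Q_2}\rangle$ be a pure state prepared by Alice, who keeps $R$, sends $Q_1$ to Bob through a noisy channel $\mathcal{E}_1$ and $Q_2$ to Charlie through a noisy channel $\mathcal{E}_2$, each realized by a unitary coupling to an environment $E_1$ (resp. $E_2$) initially in a pure state, with final state $\rho^{RQ_1'E_1'Q_2'E_2'}$. Let $P^{min}_{AB}=H_{Bob}-\chi^{E_1'}$ and $P^{min}_{AC}=H_{Charlie}-\chi^{E_2'}$ with $H_{Bob}\le\chi^{Q_1'}$, $H_{Charlie}\le\chi^{Q_2'}$, and let $\mathcal{P}_{A(BC)}$ be the optimal guaranteed privacy between Alice and the pair (Bob, Charlie) when Bob and Charlie may perform a joint measurement. Then $$P^{min}_{AB}+P^{min}_{AC}\le\mathcal{P}_{A(BC)}.$$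
   Context: Notation: $S$ is von Neumann entropy. Holevo quantities $\chi^{Q_1'},\chi^{E_1'}$ (resp. $\chi^{Q_2'},\chi^{E_2'}$) are those of Alice's classical encoding ensemble as received by Bob (resp. Charlie) and by the environment $E_1$ (resp. $E_2$), i.e. Eve; $H_{Bob}$, $H_{Charlie}$ are the classical information obtained by Bob and Charlie. Coherent informations: $I_c(A\rangle B)=S(\rho^{Q_1'})-S(\rho^{RQ_1'})$, $I_c(A\rangle C)=S(\rho^{Q_2'})-S(\rho^{RQ_2'})$, $I_c(A\rangle BC)=S(\rho^{Q_1'Q_2'})-S(\rho^{RQ_1'Q_2'})$, from marginals of the final state. Standing conventions of the framework: $\chi^{Q_1'}-\chi^{E_1'}=I_c(A\rangle B)$, $\chi^{Q_2'}-\chi^{E_2'}=I_c(A\rangle C)$. The optimal guaranteed privacy $\mathcal{P}_{A(BC)}=\sup P_G$ is the supremum over strategies of Alice and the receivers of the guaranteed privacy $P_G$ (infimum over Eve's strategies of $H_{Bob+Charlie}-H_{Eve}$, with Bob and Charlie measuring jointly), and it satisfies (Schumacher–Westmoreland bound) $\mathcal{P}_{A(BC)}\ge I_c(A\rangle BC)$. *)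

(* Defs.v *)
From HB Require Import structures.
From mathcomp Require Import all_boot all_order all_algebra.
From mathcomp Require Import sesquilinear spectral complex.
From mathcomp Require Import reals exp.
Set Implicit Arguments. Unset Strict Implicit. Unset Printing Implicit Defensive.
Import Order.TTheory GRing.Theory Num.Theory.
Local Open Scope ring_scope.
Local Open Scope complex_scope.

Section QDefs.
Variable R : realType.
Local Notation C := (R[i]).

Definition xlnx (x : R) : R := if x == 0 then 0 else x * ln x.

Definition op_mx (K : finType) (rho : K -> K -> C) : 'M[C]_#|K| :=
  \matrix_(i, j) rho (enum_val i) (enum_val j).

(* von Neumann entropy S(rho) = - sum_k lambda_k ln lambda_k, where the
   lambda_k are the eigenvalues of the (Hermitian) operator rho, given by the
   spectral decomposition of MathComp's spectral.v. *)
Definition vnS (K : finType) (rho : K -> K -> C) : R :=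
  - \sum_(k < #|K|) xlnx (complex.Re (spectral_diag (op_mx rho) 0 k)).

(* Reduced density operator of the pure state phi on the full index type F,
   keeping the factor K and tracing out the factor T, where g : K -> T -> F
   identifies K * T with F. *)
Definition reduced (F K T : finType) (phi : F -> C) (g : K -> T -> F)
  : K -> K -> C :=
  fun k k' => \sum_(t : T) phi (g k t) * (phi (g k' t))^*.

Variables dR dQ1 dE1 dQ2 dE2 : nat.

Definition Full := ('I_dR * 'I_dQ1 * 'I_dE1 * 'I_dQ2 * 'I_dE2)%type.

(* Final pure state
   (1_R (x) U1 (x) U2) (|Psi>^{R Q1 Q2} (x) |eps1>^{E1} (x) |eps2>^{E2}),
   U1 acting on Q1 E1 and U2 on Q2 E2 (composite indices via mxvec_index). *)
Definition final_state (psi : 'rV[C]_(dR * dQ1 * dQ2)) (eps1 : 'rV[C]_dE1)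
  (eps2 : 'rV[C]_dE2) (U1 : 'M[C]_(dQ1 * dE1)) (U2 : 'M[C]_(dQ2 * dE2))
  : Full -> C :=
  fun x => let: (r, q1, e1, q2, e2) := x in
  \sum_(a < dQ1) \sum_(b < dE1) \sum_(c < dQ2) \sum_(d < dE2)
    U1 (mxvec_index q1 e1) (mxvec_index a b)
    * U2 (mxvec_index q2 e2) (mxvec_index c d)
    * psi 0 (mxvec_index (mxvec_index r a) c) * eps1 0 b * eps2 0 d.

Variable phi : Full -> C.

Definition rho_Q1 := reduced phi
  (fun (q : 'I_dQ1) (t : 'I_dR * 'I_dE1 * 'I_dQ2 * 'I_dE2) =>
     (t.1.1.1, q, t.1.1.2, t.1.2, t.2)).
Definition rho_RQ1 := reduced phi
  (fun (k : 'I_dR * 'I_dQ1) (t : 'I_dE1 * 'I_dQ2 * 'I_dE2) =>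
     (k.1, k.2, t.1.1, t.1.2, t.2)).
Definition rho_Q2 := reduced phi
  (fun (q : 'I_dQ2) (t : 'I_dR * 'I_dQ1 * 'I_dE1 * 'I_dE2) =>
     (t.1.1.1, t.1.1.2, t.1.2, q, t.2)).
Definition rho_RQ2 := reduced phi
  (fun (k : 'I_dR * 'I_dQ2) (t : 'I_dQ1 * 'I_dE1 * 'I_dE2) =>
     (k.1, t.1.1, t.1.2, k.2, t.2)).
Definition rho_Q1Q2 := reduced phi
  (fun (k : 'I_dQ1 * 'I_dQ2) (t : 'I_dR * 'I_dE1 * 'I_dE2) =>
     (t.1.1, k.1, t.1.2, k.2, t.2)).
Definition rho_RQ1Q2 := reduced phi
  (fun (k : 'I_dR * 'I_dQ1 * 'I_dQ2) (t : 'I_dE1 * 'I_dE2) =>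
     (k.1.1, k.1.2, t.1, k.2, t.2)).

Definition Ic_B : R := vnS rho_Q1 - vnS rho_RQ1.
Definition Ic_C : R := vnS rho_Q2 - vnS rho_RQ2.
Definition Ic_BC : R := vnS rho_Q1Q2 - vnS rho_RQ1Q2.

End QDefs.

(* Main.v *)
(** The convention on Holevo quantities reduces the claim to superadditivity of
    the coherent information, Ic(A>B) + Ic(A>C) <= Ic(A>BC), i.e.

      S(Q1) + S(Q2) + S(RQ1Q2) <= S(Q1Q2) + S(RQ1) + S(RQ2),

    which is half the sum of three instances of strong subadditivity
    S(XYZ) + S(Y) <= S(XY) + S(YZ): for (R,Q1,Q2), for (R,Q2,Q1), and for
    (R,Q1,E1E2), where purity turns S(RQ1E1E2) into S(Q2) and S(Q1E1E2) into
    S(RQ2).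

    Strong subadditivity says that the relative entropy D(A||B) of
    A = rho_XYZ and B = 1 (x) rho_YZ does not increase when Z is traced out.
    Let A have eigenvectors u_i and eigenvalues l_i, let B have v_j and m_j, and
    put w_ij = |<v_j|u_i>|^2. For 0 < t < 1,

      Q_t(A,B) = sum_ij w_ij l_i^2 / ((1-t) m_j + t l_i)
               = max_X [2 Re tr(X^H A) - (1-t) tr(X^H B X) - t tr(X A X^H)],

    and restricting X to operators Y (x) 1 gives Q_t(A_XY,B_XY) <= Q_t(A,B).
    Since tr A = tr A_XY, the derivative of the difference of the functions
    sum_ij w_ij l_i ln((1-t) m_j + t l_i) of (A,B) and of (A_XY,B_XY) is
    (Q_t(A,B) - Q_t(A_XY,B_XY)) / (1-t) >= 0, and its increment over [0,1] is
    D(A||B) - D(A_XY||B_XY). *)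

Require Import Defs.
From HB Require Import structures.
From mathcomp Require Import all_boot all_order all_algebra.
From mathcomp Require Import sesquilinear spectral complex.
From mathcomp Require Import reals exp.
From mathcomp Require Import boolp normedtype derive realfun ring lra.
Import Order.TTheory GRing.Theory Num.Theory.
Local Open Scope ring_scope.
Local Open Scope complex_scope.

Set Implicit Arguments. Unset Strict Implicit.

Section Entropy.
Import numFieldNormedType.Exports.
Local Open Scope sesquilinear_scope.
Variable R : realType.
Local Notation C := R[i].

(** * From a resolvent inequality to a logarithmic one *)

Lemma is_derive_big_sum (I : Type) (r : seq I) (f : I -> R -> R) (df : I -> R)
    (x : R) :
  (forall k, is_derive x 1 (f k) (df k)) ->
  is_derive x 1 (fun t => \sum_(k <- r) f k t) (\sum_(k <- r) df k).
Proof.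
move=> fdf; elim: r => [|k r IHr].
  under eq_fun do rewrite big_nil.
  by rewrite big_nil; exact: is_derive_cst.
under eq_fun do rewrite big_cons.
by rewrite big_cons; exact: is_deriveD.
Qed.

(** The two sides are H(0) and H(1) for H(t) = sum of c l ln((1-t) m + t l), so it suffices that H'
    >= 0 on (0,1). The weights [c] may have either sign, which lets one sum hold a difference of two
    relative entropies. *)
Lemma sum_ln_le_of_resolvent (I : finType) (c l m : I -> R) :
  (forall k, 0 <= l k) -> (forall k, 0 <= m k) ->
  (forall k, m k = 0 -> c k * l k = 0) ->
  \sum_k c k * l k = 0 ->
  (forall t : R, 0 < t < 1 ->
     0 <= \sum_k c k * (l k ^+ 2 / ((1 - t) * m k + t * l k))) ->
  \sum_k c k * l k * ln (m k) <= \sum_k c k * l k * ln (l k).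
Proof.
move=> l_ge0 m_ge0 supp trace0 resolvent_ge0.
pose mix k (t : R) : R := (1 - t) * m k + t * l k.
(* Only terms with [c k * l k != 0] count; for these [m k] and [l k] are positive, so [mix k] stays
   positive up to both endpoints, as the mean value theorem requires. *)
have mix_gt0 k (t : R) : c k * l k != 0 -> 0 <= t <= 1 -> 0 < mix k t.
  move=> clk /andP[t0 t1].
  have mk : 0 < m k by rewrite lt0r m_ge0 andbT; apply: contra_neq clk; exact: supp.
  have lk : 0 < l k.
    by rewrite lt0r l_ge0 andbT; apply: contra_neq clk => ->; rewrite mulr0.
  rewrite /mix; have [->|tn0] := eqVneq t 0; first by lra.
  have tgt0 : 0 < t by rewrite lt0r tn0.
  by rewrite ltr_wpDl ?mulr_gt0 // mulr_ge0 ?subr_ge0.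
pose H t := \sum_k c k * l k * ln (mix k t).
pose dH t := \sum_k c k * l k * ((l k - m k) / mix k t).
have dHE (t : R) : 0 <= t <= 1 -> is_derive t 1 H (dH t).
  move=> t01; apply: is_derive_big_sum => k.
  have [cl0|cl0] := eqVneq (c k * l k) 0.
    rewrite cl0 mul0r; under eq_fun do rewrite mul0r; exact: is_derive_cst.
  have dmix : is_derive t 1 (mix k) (l k - m k).
    rewrite /mix; apply: is_derive_eq.
    by rewrite !scaler0 add0r /GRing.scale /=; ring.
  have dln : is_derive t 1 (fun t => ln (mix k t)) ((mix k t)^-1 * (l k - m k)).
    exact: (is_derive1_comp (is_derive1_ln (mix_gt0 k t cl0 t01)) dmix).
  rewrite (mulrC (l k - m k)); exact: is_deriveZ.
have [x x01 Hx] : exists2 x, x \in `]0, 1[%R & H 1 - H 0 = dH x * (1 - 0).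
  apply: MVT ltr01 _ _ => [x|].
    by rewrite in_itv /= => /andP[x0 x1]; apply: dHE; rewrite !ltW.
  apply: derivable_within_continuous => x; rewrite in_itv /= => x01.
  by have [] := dHE x x01.
have H0 : H 0 = \sum_k c k * l k * ln (m k).
  by apply: eq_bigr => k _; rewrite /mix subr0 mul1r mul0r addr0.
have H1 : H 1 = \sum_k c k * l k * ln (l k).
  by apply: eq_bigr => k _; rewrite /mix subrr mul0r add0r mul1r.
rewrite -H0 -H1 -subr_ge0 Hx subr0 mulr1.
rewrite in_itv /= in x01; have /andP[x0 x1] := x01.
(* Termwise, l (l - m) / mix = (l^2 / mix - l) / (1 - x); the second part sums to zero by
   [trace0]. *)
have -> : dH x = (1 - x)^-1 *
    (\sum_k c k * (l k ^+ 2 / mix k x) - \sum_k c k * l k).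
  rewrite -sumrB mulr_sumr; apply: eq_bigr => k _.
  have [cl0|cl0] := eqVneq (c k * l k) 0.
    by rewrite expr2 !mulrA cl0 !mul0r subrr mulr0.
  have /lt0r_neq0 : 0 < mix k x by rewrite mix_gt0 // !ltW.
  rewrite /mix => mixn0; field.
  by rewrite mixn0 subr_eq0 gt_eqF.
by rewrite trace0 subr0 mulr_ge0 ?resolvent_ge0 // invr_ge0 subr_ge0 ltW.
Qed.

(** * The resolvent form and its maximum *)

Definition sqnorm (z : C) : R := complex.Re z ^+ 2 + complex.Im z ^+ 2.

Lemma sqnorm_ge0 z : 0 <= sqnorm z.
Proof. by rewrite addr_ge0 ?sqr_ge0. Qed.

Lemma mul_conjC_sqnorm z : Num.conj z * z = (sqnorm z)%:C.
Proof.
case: z => a b; rewrite /sqnorm /Num.conj /=; simpc.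
by congr (_ +i* _); ring.
Qed.

Lemma Re_mul_conjC_real z (r : R) : complex.Re (Num.conj z * (r%:C * z)) = r * sqnorm z.
Proof. by rewrite mulrCA mul_conjC_sqnorm; case: z => a b /=; rewrite mul0r subr0. Qed.

(** Where a denominator of [Q_t] vanishes, so does its numerator, and the convention x / 0 = 0 gives
    the term its right value. *)
Lemma mix_eq0 (t l m : R) :
  0 < t < 1 -> 0 <= l -> 0 <= m -> (1 - t) * m + t * l = 0 -> l = 0.
Proof.
move=> /andP[t0 t1] l0 m0 /eqP.
rewrite paddr_eq0 ?mulr_ge0 ?subr_ge0 ?(ltW t0) ?(ltW t1) // => /andP[_].
by rewrite mulf_eq0 gt_eqF //= => /eqP.
Qed.

Lemma Re_mul_real (z : C) (r : R) : complex.Re (z * r%:C) = complex.Re z * r.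
Proof. by case: z => a b /=; rewrite mulr0 subr0. Qed.

Lemma Re_sum (I : Type) (r : seq I) (P : pred I) (F : I -> C) :
  complex.Re (\sum_(i <- r | P i) F i) = \sum_(i <- r | P i) complex.Re (F i).
Proof. exact: (raddf_sum (@complex.Re R)). Qed.

Lemma trmxC_mul m n p (A : 'M[C]_(m, n)) (B : 'M[C]_(n, p)) :
  (A *m B)^t* = B^t* *m A^t*.
Proof. by rewrite trmx_mul map_mxM. Qed.

(** [N] is kept apart from [n] because lifted eigenbases are indexed by the cardinal of a product
    type; hence the two unitarity equations. *)
Definition spectral_dec n (A : 'M[C]_n) N (U : 'M[C]_(n, N)) (l : 'I_N -> R) :=
  [/\ U *m U^t* = 1%:M, U^t* *m U = 1%:M
    & A = U *m diag_mx (\row_i (l i)%:C) *m U^t*].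

Definition overlap n N N' (U : 'M[C]_(n, N)) (V : 'M[C]_(n, N')) i j : R :=
  sqnorm ((V^t* *m U) j i).

(** The functional maximised over [X] in the formula for [Q_t]; being free of eigenbases, it can be
    compared across a partial trace. *)
Definition resolvent_form (t : R) n (A B X : 'M[C]_n) : R :=
  2 * complex.Re (\tr (X^t* *m A)) - (1 - t) * complex.Re (\tr (X^t* *m B *m X))
  - t * complex.Re (\tr (X *m A *m X^t*)).

Section Pair.
Variables (n N N' : nat) (A B : 'M[C]_n).
Variables (U : 'M[C]_(n, N)) (l : 'I_N -> R) (V : 'M[C]_(n, N')) (m : 'I_N' -> R).
Hypotheses (dA : spectral_dec A U l) (dB : spectral_dec B V m).

(** In the coordinates x = V^H X U the quadratic terms are diagonal, so the form splits into one
    scalar quadratic per entry of x. *)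
Lemma resolvent_formE t X (x := V^t* *m X *m U) :
  resolvent_form t A B X =
  \sum_i \sum_j (2 * l i * complex.Re (Num.conj (x j i) * (V^t* *m U) j i)
                 - ((1 - t) * m j + t * l i) * sqnorm (x j i)).
Proof.
case: dA => UU _ AE; case: dB => VV _ BE.
have xT : x^t* = U^t* *m X^t* *m V by rewrite /x !trmxC_mul trmxCK mulmxA.
have tr1 : \tr (X^t* *m A) = \tr (x^t* *m ((V^t* *m U) *m diag_mx (\row_i (l i)%:C))).
  rewrite xT AE !mulmxA -(mulmxA _ V) VV mulmx1 mxtrace_mulC.
  by rewrite !mulmxA.
have tr2 : \tr (X^t* *m B *m X) = \tr (x^t* *m (diag_mx (\row_i (m i)%:C) *m x)).
  rewrite xT BE /x -!mulmxA (mxtrace_mulC (U^t*)) !mulmxA.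
  by rewrite -(mulmxA _ U) UU mulmx1.
have tr3 : \tr (X *m A *m X^t*) = \tr (x *m (diag_mx (\row_i (l i)%:C) *m x^t*)).
  rewrite xT AE /x -!mulmxA (mxtrace_mulC (V^t*)) !mulmxA.
  by rewrite -(mulmxA _ V (V^t*)) VV mulmx1.
clearbody x; rewrite /resolvent_form tr1 tr2 tr3 mul_mx_diag !mul_diag_mx.
rewrite /mxtrace !Re_sum !mulr_sumr.
have -> : \sum_j t * complex.Re ((x *m (\matrix_(i, j0)
      ((\row_i0 (l i0)%:C) 0 i * x^t* i j0))) j j) =
    \sum_i \sum_j t * (l i * sqnorm (x j i)).
  rewrite exchange_big /=; apply: eq_bigr => j _.
  rewrite !mxE Re_sum mulr_sumr; apply: eq_bigr => i _.
  rewrite !mxE -Re_mul_conjC_real; congr (t * complex.Re _); ring.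
rewrite -!sumrB; apply: eq_bigr => i _.
rewrite !mxE !Re_sum !mulr_sumr -!sumrB; apply: eq_bigr => j _.
rewrite !mxE [in X in _ - X - _]Re_mul_conjC_real.
rewrite mulrA Re_mul_real mulrDl.
ring.
Qed.

Hypotheses (l_ge0 : forall i, 0 <= l i) (m_ge0 : forall j, 0 <= m j).
Variable t : R.
Hypothesis t01 : 0 < t < 1.

Definition resolvent_sum :=
  \sum_i \sum_j overlap U V i j * (l i ^+ 2 / ((1 - t) * m j + t * l i)).

(** Complete the square entrywise: with c = (V^H U)_ji and d the denominator, the gap is |l c - d
    x|^2 / d if d > 0, and both terms are zero if d = 0. *)
Lemma resolvent_form_le X : resolvent_form t A B X <= resolvent_sum.
Proof.
rewrite resolvent_formE; apply: ler_sum => i _; apply: ler_sum => j _.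
rewrite /overlap; set c := (V^t* *m U) j i; set x := (_ *m U) j i.
have /andP[t0 t1] := t01.
have [d0|d0] := eqVneq ((1 - t) * m j + t * l i) 0.
  have l0 := mix_eq0 t01 (l_ge0 i) (m_ge0 j) d0.
  by rewrite d0 l0 expr0n /= mul0r !mulr0 !mul0r subr0 mulr0.
set d := (1 - t) * m j + t * l i in d0 *.
have dp : 0 < d.
  by rewrite lt0r d0 /d addr_ge0 // mulr_ge0 ?subr_ge0 ?(ltW t0) ?(ltW t1).
rewrite -subr_ge0.
case: c x => a b [p q]; rewrite /sqnorm /Num.conj /=.
have -> : (a ^+ 2 + b ^+ 2) * (l i ^+ 2 / d) -
    (2 * l i * (p * a - - q * b) - d * (p ^+ 2 + q ^+ 2)) =
    ((l i * a - d * p) ^+ 2 + (l i * b - d * q) ^+ 2) / d by field.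
by rewrite divr_ge0 ?(ltW dp) // addr_ge0 ?sqr_ge0.
Qed.

Lemma resolvent_form_max : exists X, resolvent_form t A B X = resolvent_sum.
Proof.
(* The completed square vanishes at x = (l / d) c; where d = 0 the entry is 0 by convention. *)
pose x := \matrix_(j, i)
  ((l i / ((1 - t) * m j + t * l i))%:C * (V^t* *m U) j i).
exists (V *m x *m U^t*); rewrite resolvent_formE.
have -> : V^t* *m (V *m x *m U^t*) *m U = x.
  case: dA => _ UU _; case: dB => _ VV _.
  by rewrite !mulmxA VV mul1mx -mulmxA UU mulmx1.
apply: eq_bigr => i _; apply: eq_bigr => j _.
rewrite /overlap ![x _ _]mxE; set c := (V^t* *m U) j i.
have [d0|d0] := eqVneq ((1 - t) * m j + t * l i) 0.
  have l0 := mix_eq0 t01 (l_ge0 i) (m_ge0 j) d0.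
  by rewrite d0 l0 expr0n /= !(mul0r, mulr0) subr0.
case: c => a b; rewrite /sqnorm /Num.conj /=; field; exact: d0.
Qed.
End Pair.

Section Overlap.
Variables (n N N' : nat) (A : 'M[C]_n).
Variables (U : 'M[C]_(n, N)) (l : 'I_N -> R) (V : 'M[C]_(n, N')).
Hypothesis dA : spectral_dec A U l.

(** Column [i] of V^H U is a unit vector. *)
Lemma sum_overlap i : V *m V^t* = 1%:M -> \sum_j overlap U V i j = 1.
Proof.
move=> VV; case: dA => _ UU _.
have : ((V^t* *m U)^t* *m (V^t* *m U)) i i = 1.
  by rewrite trmxC_mul trmxCK !mulmxA -(mulmxA _ V) VV mulmx1 UU !mxE eqxx.
rewrite mxE => /(congr1 (@complex.Re R)); rewrite Re_sum /= => <-.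
by apply: eq_bigr => j _; rewrite [_^t* _ _]mxE [_^T _ _]mxE mul_conjC_sqnorm.
Qed.

(** Both sides are <v_j|A|v_j>, the left one expanded in the eigenbasis of [A]. *)
Lemma sum_overlap_weight j :
  \sum_i overlap U V i j * l i = complex.Re ((V^t* *m A *m V) j j).
Proof.
case: dA => _ _ AE.
have -> : V^t* *m A *m V =
    (V^t* *m U) *m (diag_mx (\row_i (l i)%:C) *m (V^t* *m U)^t*).
  by rewrite AE trmxC_mul trmxCK !mulmxA.
rewrite /overlap; move: (V^t* *m U) => y.
rewrite mul_diag_mx mxE Re_sum; apply: eq_bigr => i _.
by rewrite !mxE mulrC -Re_mul_conjC_real; congr (complex.Re _); ring.
Qed.

Lemma trace_spectral : complex.Re (\tr A) = \sum_i l i.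
Proof.
case: dA => _ UU ->; rewrite mxtrace_mulC mulmxA UU mul1mx mxtrace_diag Re_sum.
by apply: eq_bigr => i _; rewrite mxE.
Qed.

End Overlap.

(** * Partial trace and monotonicity of relative entropy *)

Section PartialTrace.
Variables (I : finType) (n n' : nat) (J : I -> 'M[C]_(n, n')).
Hypothesis J_orth : forall z z', (J z)^t* *m J z' = (z == z')%:R%:M.

(* The [J z] are isometries with orthogonal ranges spanning the big space:
   [J z] is |l> |-> |l>|z> for a tensor factor indexed by [z]. Then [lift_mx Y]
   is Y (x) 1 and [ptrace] is the partial trace over that factor. *)
Definition lift_mx (Y : 'M[C]_n') : 'M[C]_n := \sum_z J z *m Y *m (J z)^t*.
Definition ptrace (A : 'M[C]_n) : 'M[C]_n' := \sum_z (J z)^t* *m A *m J z.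

Lemma lift_mxC Y : (lift_mx Y)^t* = lift_mx (Y^t*).
Proof.
rewrite /lift_mx raddf_sum raddf_sum; apply: eq_bigr => z _ /=.
by rewrite !trmxC_mul trmxCK mulmxA.
Qed.

Lemma lift_mxM Y Z : lift_mx Y *m lift_mx Z = lift_mx (Y *m Z).
Proof.
rewrite /lift_mx mulmx_suml; apply: eq_bigr => z _.
rewrite mulmx_sumr (bigD1 z) //= big1 ?addr0 => [|z' z'z].
  by rewrite -!mulmxA (mulmxA _ (J z)) J_orth eqxx mul1mx.
rewrite -!mulmxA (mulmxA _ (J z')) J_orth eq_sym (negPf z'z).
by rewrite raddf0 mul0mx !mulmx0.
Qed.

(** Makes [ptrace] the adjoint of [lift_mx] for the trace pairing. *)
Lemma trace_lift_mx A Y : \tr (A *m lift_mx Y) = \tr (ptrace A *m Y).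
Proof.
rewrite /lift_mx /ptrace mulmx_suml mulmx_sumr !raddf_sum.
by apply: eq_bigr => z _ /=; rewrite !mulmxA mxtrace_mulC !mulmxA.
Qed.

(** [lift_mx] respects products and adjoints, so by cyclicity each trace pairs [A] or [B] with a
    lifted matrix, and adjointness brings it down. *)
Lemma resolvent_form_lift t A B X :
  resolvent_form t A B (lift_mx X) = resolvent_form t (ptrace A) (ptrace B) X.
Proof.
have E (P Q S : 'M[C]_n) : \tr (P *m Q *m S) = \tr (Q *m (S *m P)).
  by rewrite -mulmxA mxtrace_mulC mulmxA.
have E' (P Q S : 'M[C]_n') : \tr (P *m Q *m S) = \tr (Q *m (S *m P)).
  by rewrite -mulmxA mxtrace_mulC mulmxA.
rewrite /resolvent_form !E !E' lift_mxC !lift_mxM !trace_lift_mx.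
by rewrite mxtrace_mulC trace_lift_mx (mxtrace_mulC (X^t*)).
Qed.

Hypothesis J_complete : lift_mx 1%:M = 1%:M.

Lemma trace_ptrace A : \tr (ptrace A) = \tr A.
Proof. by rewrite -[RHS](congr1 mxtrace (mulmx1 A)) -J_complete trace_lift_mx mulmx1. Qed.

(** Since [p] is the diagonal of [A] in the eigenbasis of [B], [\sum_j p j * ln (m j)] is tr(A ln
    B). The conditions at the zeros of [m] and [m'] are the support inclusions that make the
    relative entropies finite. *)
Lemma relative_entropy_mono N M N' M' (A B : 'M[C]_n)
    (U : 'M_(n, N)) (V : 'M_(n, M)) (U' : 'M_(n', N')) (V' : 'M_(n', M'))
    (l : 'I_N -> R) (m : 'I_M -> R) (l' : 'I_N' -> R) (m' : 'I_M' -> R) :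
  spectral_dec A U l -> spectral_dec B V m ->
  spectral_dec (ptrace A) U' l' -> spectral_dec (ptrace B) V' m' ->
  (forall i, 0 <= l i) -> (forall i, 0 <= m i) ->
  (forall i, 0 <= l' i) -> (forall i, 0 <= m' i) ->
  let p j := complex.Re ((V^t* *m A *m V) j j) in
  let p' j := complex.Re ((V'^t* *m ptrace A *m V') j j) in
  (forall j, m j = 0 -> p j = 0) -> (forall j, m' j = 0 -> p' j = 0) ->
  \sum_i l' i * ln (l' i) - \sum_j p' j * ln (m' j) <=
  \sum_i l i * ln (l i) - \sum_j p j * ln (m j).
Proof.
move=> dA dB dA' dB' l0 m0 l'0 m'0 p p' mp mp'.
have VV : V *m V^t* = 1%:M by case: dB.
have VV' : V' *m V'^t* = 1%:M by case: dB'.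
(* One signed family carries both pairs: overlaps of (A, B) count positively, those of the reduced
   pair negatively. *)
pose T := (('I_N * 'I_M) + ('I_N' * 'I_M'))%type.
pose c (k : T) := match k with
  | inl p => overlap U V p.1 p.2 | inr p => - overlap U' V' p.1 p.2 end.
pose L (k : T) := match k with inl p => l p.1 | inr p => l' p.1 end.
pose K (k : T) := match k with inl p => m p.2 | inr p => m' p.2 end.
have sumT (f : T -> R) : \sum_k f k =
    \sum_i \sum_j f (inl (i, j)) + \sum_i \sum_j f (inr (i, j)).
  by rewrite big_sumType /=; congr (_ + _);
     rewrite pair_bigA; apply: eq_bigr; case.
have suml (n0 N0 M0 : nat) (A0 : 'M[C]_n0) (U0 : 'M_(n0, N0)) (V0 : 'M_(n0, M0)) a b :
    spectral_dec A0 U0 a -> V0 *m V0^t* = 1%:M ->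
    \sum_i \sum_j overlap U0 V0 i j * b i = \sum_i b i.
  move=> d0 VV0; apply: eq_bigr => i _.
  by rewrite -mulr_suml (sum_overlap d0) // mul1r.
have summ (n0 N0 M0 : nat) (A0 : 'M[C]_n0) (U0 : 'M_(n0, N0)) (V0 : 'M_(n0, M0)) a b :
    spectral_dec A0 U0 a ->
    \sum_i \sum_j overlap U0 V0 i j * a i * b j =
    \sum_j complex.Re ((V0^t* *m A0 *m V0) j j) * b j.
  move=> d0; rewrite exchange_big; apply: eq_bigr => j _ /=.
  by rewrite -mulr_suml (sum_overlap_weight V0 d0).
(* A zero diagonal entry is a sum of nonnegative terms overlap * eigenvalue, so each term is
   zero. *)
have supp (n0 N0 M0 : nat) (A0 : 'M[C]_n0) (U0 : 'M_(n0, N0)) (V0 : 'M_(n0, M0)) a i j :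
    spectral_dec A0 U0 a -> (forall i, 0 <= a i) ->
    complex.Re ((V0^t* *m A0 *m V0) j j) = 0 -> overlap U0 V0 i j * a i = 0.
  move=> d0 a0; rewrite -(sum_overlap_weight V0 d0) => /psumr_eq0P -> // k _.
  by rewrite mulr_ge0 ?sqnorm_ge0.
have main : \sum_k c k * L k * ln (K k) <= \sum_k c k * L k * ln (L k).
  apply: sum_ln_le_of_resolvent; [by case=> -[i j] /=|by case=> -[i j] /=|..].
  - case=> -[i j] /=; first by move=> /mp; exact: (supp _ _ _ _ _ _ _ i j dA).
    by move=> /mp' pj; rewrite mulNr (supp _ _ _ _ _ _ _ i j dA') ?oppr0.
  - rewrite sumT /=; under [X in _ + X]eq_bigr do under eq_bigr do rewrite mulNr.
    under [X in _ + X]eq_bigr do rewrite sumrN.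
    rewrite sumrN (suml _ _ _ _ _ _ _ _ dA VV) (suml _ _ _ _ _ _ _ _ dA' VV').
    by rewrite -(trace_spectral dA) -(trace_spectral dA') trace_ptrace subrr.
  move=> t t01; rewrite sumT /=.
  under [X in _ + X]eq_bigr do under eq_bigr do rewrite mulNr.
  under [X in _ + X]eq_bigr do rewrite sumrN.
  rewrite sumrN subr_ge0.
  (* The maximiser for the reduced pair, once lifted, is a competitor for the original pair. *)
  have [X XE] := resolvent_form_max dA' dB' l'0 m'0 t01.
  have := resolvent_form_le dA dB l0 m0 t01 (lift_mx X).
  by rewrite resolvent_form_lift XE.
move: main; rewrite !sumT /=.
under [X in _ + X <= _]eq_bigr do under eq_bigr do rewrite !mulNr.
under [X in _ + X <= _]eq_bigr do rewrite sumrN.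
under [X in _ <= _ + X]eq_bigr do under eq_bigr do rewrite !mulNr -mulrA.
under [X in _ <= _ + X]eq_bigr do rewrite sumrN.
under [X in _ <= X + _]eq_bigr do under eq_bigr do rewrite -mulrA.
rewrite !sumrN (summ _ _ _ _ _ _ _ (fun j => ln (m j)) dA).
rewrite (summ _ _ _ _ _ _ _ (fun j => ln (m' j)) dA').
rewrite (suml _ _ _ _ _ _ _ (fun i => l i * ln (l i)) dA VV).
rewrite (suml _ _ _ _ _ _ _ (fun i => l' i * ln (l' i)) dA' VV').
rewrite /p /p'; lra.
Qed.

End PartialTrace.

Lemma sum_enum_val (V : nmodType) (T : finType) (F : T -> V) :
  \sum_(i < #|T|) F (enum_val i) = \sum_t F t.
Proof. by rewrite (reindex enum_rank); [apply: eq_bigr => t _; rewrite enum_rankK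
  | exact/onW_bij/enum_rank_bij]. Qed.

(** * Eigenbases of Y (x) 1 and strong subadditivity for matrices *)

Section Block.
Variables (I : finType) (n p N : nat) (J : I -> 'M[C]_(n, p)).
Hypothesis J_orth : forall x x', (J x)^t* *m J x' = (x == x')%:R%:M.
Hypothesis J_complete : lift_mx J 1%:M = 1%:M.

(** The columns are the vectors v_i (x) |x>; [enum_val] turns a column number into the pair (x,
    i). *)
Definition lift_basis (V : 'M[C]_(p, N)) : 'M[C]_(n, #|{: I * 'I_N}|) :=
  \matrix_(i, j) (J (enum_val j).1 *m V) i (enum_val j).2.

Lemma lift_basis_conj V G j k :
  ((lift_basis V)^t* *m G *m lift_basis V) j k =
  (V^t* *m ((J (enum_val j).1)^t* *m G *m J (enum_val k).1) *m V)
    (enum_val j).2 (enum_val k).2.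
Proof.
transitivity (((J (enum_val j).1 *m V)^t* *m G *m (J (enum_val k).1 *m V))
    (enum_val j).2 (enum_val k).2); last by rewrite trmxC_mul !mulmxA.
rewrite !mxE; apply: eq_bigr => b _; rewrite !mxE; congr (_ * _).
by apply: eq_bigr => a _; rewrite !mxE.
Qed.

Lemma lift_basis_diag V (m : 'I_N -> R) :
  lift_basis V *m diag_mx (\row_j (m (enum_val j).2)%:C) *m (lift_basis V)^t* =
  lift_mx J (V *m diag_mx (\row_j (m j)%:C) *m V^t*).
Proof.
have termE x : J x *m (V *m diag_mx (\row_j (m j)%:C) *m V^t*) *m (J x)^t* =
    (J x *m V) *m diag_mx (\row_j (m j)%:C) *m (J x *m V)^t*.
  by rewrite trmxC_mul !mulmxA.
rewrite /lift_mx; under eq_bigr do rewrite termE mul_mx_diag.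
apply/matrixP => a b; rewrite summxE mul_mx_diag mxE.
transitivity (\sum_(j < #|{: I * 'I_N}|)
    (J (enum_val j).1 *m V) a (enum_val j).2 * (m (enum_val j).2)%:C *
    Num.conj ((J (enum_val j).1 *m V) b (enum_val j).2)).
  by apply: eq_bigr => j _; rewrite !mxE.
rewrite (sum_enum_val (fun y : I * 'I_N => (J y.1 *m V) a y.2 * (m y.2)%:C *
    Num.conj ((J y.1 *m V) b y.2))).
rewrite -(pair_bigA _ (fun x i => (J x *m V) a i * (m i)%:C *
    Num.conj ((J x *m V) b i))) /=; apply: eq_bigr => x _.
by rewrite [in RHS]mxE; apply: eq_bigr => i _; rewrite !mxE.
Qed.

Lemma lift_basis_spectral A V (m : 'I_N -> R) :
  spectral_dec A V m ->
  spectral_dec (lift_mx J A) (lift_basis V) (fun j => m (enum_val j).2).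
Proof.
case=> VV VV' AE.
have ones k : diag_mx (\row_(j < k) (1 : R)%:C) = 1%:M.
  rewrite -diag_const_mx; congr diag_mx; apply/matrixP => a b; rewrite !mxE //.
split; last by rewrite lift_basis_diag -AE.
  (* Completeness is the diagonal formula with all eigenvalues equal to 1. *)
  have := lift_basis_diag V (fun=> 1).
  by rewrite !ones !mulmx1 VV J_complete.
apply/matrixP => j k; have := lift_basis_conj V 1%:M j k.
rewrite !mulmx1 J_orth => ->.
rewrite [RHS]mxE -[j == k](inj_eq (@enum_val_inj _ _)).
case: (enum_val j) (enum_val k) => [x a] [y b] /=; rewrite xpair_eqE.
case: eqVneq => _ /=; last by rewrite raddf0 mulmx0 mul0mx mxE.
by rewrite mulmx1 VV' mxE.
Qed.

End Block.

(* [J] adds the factor Z and [N] the factor X: [J] goes from XY to XYZ, [N] from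
   YZ to XYZ, [J'] from Y to YZ and [N'] from Y to XY. *)
Lemma strong_subadditivity_mx (I K : finType) (n p q r : nat)
    (J : I -> 'M[C]_(n, p)) (N : K -> 'M[C]_(n, q))
    (J' : I -> 'M[C]_(q, r)) (N' : K -> 'M[C]_(p, r)) :
  (forall x x', (J x)^t* *m J x' = (x == x')%:R%:M) ->
  lift_mx J 1%:M = 1%:M ->
  (forall x x', (N x)^t* *m N x' = (x == x')%:R%:M) ->
  lift_mx N 1%:M = 1%:M ->
  (forall x x', (N' x)^t* *m N' x' = (x == x')%:R%:M) ->
  lift_mx N' 1%:M = 1%:M ->
  (forall x y, J x *m N' y = N y *m J' x) ->
  (forall x y, (J x)^t* *m N y = N' y *m (J' x)^t*) ->
  forall (a b c d : nat) (A : 'M[C]_n)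
    (U : 'M_(n, a)) (V : 'M_(p, b)) (W : 'M_(q, c)) (Z : 'M_(r, d))
    (l : 'I_a -> R) (l' : 'I_b -> R) (m : 'I_c -> R) (m' : 'I_d -> R),
  spectral_dec A U l -> spectral_dec (ptrace J A) V l' ->
  spectral_dec (ptrace N A) W m -> spectral_dec (ptrace N' (ptrace J A)) Z m' ->
  (forall i, 0 <= l i) -> (forall i, 0 <= l' i) ->
  (forall i, 0 <= m i) -> (forall i, 0 <= m' i) ->
  \sum_i l' i * ln (l' i) - \sum_i m' i * ln (m' i) <=
  \sum_i l i * ln (l i) - \sum_i m i * ln (m i).
Proof.
move=> Jo Jc No Nc No' Nc' JN JN' a b c d A U V W Z l l' m m'.
move=> dA dA' dB dB' l0 l'0 m0 m'0.
(* Tracing Z out of 1 (x) rho_YZ leaves 1 (x) rho_Y: the partial traces over X and Z commute by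
   [JN], and [JN'] with its adjoint moves [J] past [N]. *)
have ptB : ptrace J (lift_mx N (ptrace N A)) =
    lift_mx N' (ptrace N' (ptrace J A)).
  have -> : ptrace N' (ptrace J A) = ptrace J' (ptrace N A).
    rewrite /ptrace; under eq_bigr do rewrite mulmx_sumr mulmx_suml.
    under [RHS]eq_bigr do rewrite mulmx_sumr mulmx_suml.
    rewrite exchange_big; apply: eq_bigr => x _; apply: eq_bigr => y _ /=.
    by rewrite !mulmxA -!trmxC_mul -!mulmxA JN.
  move: (ptrace N A) => S; rewrite /ptrace /lift_mx; under eq_bigr do rewrite mulmx_sumr mulmx_suml.
  rewrite exchange_big; apply: eq_bigr => y _ /=.
  rewrite mulmx_sumr mulmx_suml; apply: eq_bigr => x _.
  rewrite !mulmxA JN' -!mulmxA; congr (_ *m (_ *m (_ *m _))).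
  by rewrite -[RHS]trmxCK [in RHS]trmxC_mul trmxCK -JN' trmxC_mul trmxCK.
have dL := lift_basis_spectral No Nc dB.
have := lift_basis_spectral No' Nc' dB'; rewrite -ptB => dL'.
(* The diagonal [g] of G in the lifted eigenbasis is nonnegative and sums over the added factor to
   the eigenvalue [v i] of the partial trace. This gives the support condition and, for instance,
   tr(A ln B) = tr(rho_YZ ln rho_YZ). *)
have key (k : finType) (s t e f : nat) (Q : k -> 'M[C]_(s, t)) (G : 'M[C]_s)
    (X : 'M_(s, e)) (Y : 'M_(t, f)) (u : 'I_e -> R) (v : 'I_f -> R) :
    (forall i, 0 <= u i) -> spectral_dec G X u -> spectral_dec (ptrace Q G) Y v ->
    let g j := complex.Re (((lift_basis Q Y)^t* *m G *m lift_basis Q Y) j j) in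
    (forall j, v (enum_val j).2 = 0 -> g j = 0) /\
    \sum_j g j * ln (v (enum_val j).2) = \sum_i v i * ln (v i).
  move=> u0 dG dQ g.
  pose h (y : k * 'I_f) := complex.Re ((Y^t* *m ((Q y.1)^t* *m G *m Q y.1) *m Y) y.2 y.2).
  have gh j : g j = h (enum_val j) by rewrite /g lift_basis_conj.
  have h0 y : 0 <= h y.
    rewrite -[y]enum_rankK -gh /g -(sum_overlap_weight _ dG).
    by apply: sumr_ge0 => i _; rewrite mulr_ge0 ?sqnorm_ge0.
  have sumh i : \sum_x h (x, i) = v i.
    have : complex.Re ((Y^t* *m ptrace Q G *m Y) i i) = v i.
      case: dQ => _ YY ->; rewrite !mulmxA YY mul1mx -mulmxA YY mulmx1.
      by rewrite !mxE eqxx.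
    rewrite /ptrace mulmx_sumr mulmx_suml summxE Re_sum => <-.
    by apply: eq_bigr.
  split=> [j|].
    rewrite gh; case: (enum_val j) => x i /=; rewrite -sumh => /psumr_eq0P -> //.
  under eq_bigr do rewrite gh.
  rewrite (sum_enum_val (fun y => h y * ln (v y.2))).
  rewrite (eq_bigr (fun y => h (y.1, y.2) * ln (v y.2))); last by case.
  rewrite -(pair_bigA _ (fun x i => h (x, i) * ln (v i))) exchange_big /=.
  by apply: eq_bigr => i _; rewrite -mulr_suml sumh.
have [s1 e1] := key _ _ _ _ _ N _ _ _ _ _ l0 dA dB.
have [s2 e2] := key _ _ _ _ _ N' _ _ _ _ _ l'0 dA' dB'.
rewrite -e1 -e2; apply: (relative_entropy_mono Jo Jc dA dL dA' dL') => //.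
Qed.

(** * Spectra of M M^H and M^H M *)

Lemma psd_spectral_dec n p (M : 'M[C]_(n, p)) (A := M *m M^t*)
    (l := fun k => complex.Re (spectral_diag A 0 k)) :
  spectral_dec A ((spectralmx A)^t*) l /\ forall k, 0 <= l k.
Proof.
have AC : A^t* = A by rewrite /A trmxC_mul trmxCK.
have AE : A = (spectralmx A)^t* *m diag_mx (spectral_diag A) *m spectralmx A.
  rewrite -invmx_unitary ?spectral_unitarymx //.
  by apply/orthomx_spectralP/normalmxP; rewrite AC.
have P1 : spectralmx A *m (spectralmx A)^t* = 1%:M.
  by apply/unitarymxP; exact: spectral_unitarymx.
have P2 : (spectralmx A)^t* *m spectralmx A = 1%:M.
  rewrite -[X in _ *m X]trmxCK; apply/unitarymxP.
  by rewrite trmxC_unitary spectral_unitarymx.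
(* The eigenvalues are squared row norms of [spectralmx A *m M], hence real and nonnegative, so
   taking real parts loses nothing. *)
have DE : diag_mx (spectral_diag A) = (spectralmx A *m M) *m (spectralmx A *m M)^t*.
  rewrite trmxC_mul mulmxA -(mulmxA _ M) -/A [X in _ *m X *m _]AE.
  by rewrite !mulmxA P1 mul1mx -mulmxA P1 mulmx1.
have dE k : spectral_diag A 0 k =
    (\sum_j sqnorm ((spectralmx A *m M) k j))%:C.
  have := congr1 (fun X : 'M_n => X k k) DE.
  rewrite [in LHS]mxE eqxx mulr1n => ->; rewrite mxE raddf_sum /=.
  apply: eq_bigr => j _; rewrite [X in _ * X]mxE [X in _ * Num.conj X]mxE.
  by rewrite mulrC mul_conjC_sqnorm.
split; last by move=> k; rewrite /l dE /=; apply: sumr_ge0 => j _; exact: sqnorm_ge0.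
rewrite /spectral_dec trmxCK; split=> //.
rewrite [LHS]AE; congr (_ *m diag_mx _ *m _).
by apply/rowP => k; rewrite !mxE /l dE.
Qed.

(** No multiplicities are counted: W = U^H M V intertwines the two diagonal matrices, so l_i = m_j
    wherever W_ij is nonzero, while l_i and m_j are the row and column sums of |W_ij|^2. *)
Lemma schmidt_entropy n p N N' (M : 'M[C]_(n, p)) (U : 'M_(n, N)) (V : 'M_(p, N'))
    (l : 'I_N -> R) (m : 'I_N' -> R) :
  spectral_dec (M *m M^t*) U l -> spectral_dec (M^t* *m M) V m ->
  \sum_i l i * ln (l i) = \sum_j m j * ln (m j).
Proof.
case=> UU UU' AE [VV VV' BE]; pose W := U^t* *m M *m V.
have WT : W^t* = V^t* *m M^t* *m U by rewrite /W !trmxC_mul trmxCK mulmxA.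
have WW : W *m W^t* = diag_mx (\row_i (l i)%:C).
  rewrite WT /W !mulmxA -(mulmxA _ V) VV mulmx1 -(mulmxA _ M) AE.
  by rewrite !mulmxA UU' mul1mx -mulmxA UU' mulmx1.
have WW' : W^t* *m W = diag_mx (\row_i (m i)%:C).
  rewrite WT /W !mulmxA -(mulmxA _ U) UU mulmx1 -(mulmxA _ _ M) BE.
  by rewrite !mulmxA VV' mul1mx -mulmxA VV' mulmx1.
clearbody W.
have lW i j : l i * sqnorm (W i j) = m j * sqnorm (W i j).
  have : diag_mx (\row_i (l i)%:C) *m W = W *m diag_mx (\row_i (m i)%:C).
    by rewrite -WW -WW' mulmxA.
  move=> /(congr1 (fun X : 'M_(N, N') => X i j)).
  rewrite mul_diag_mx mul_mx_diag !mxE mulrC => lm.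
  have [->|] := eqVneq (W i j) 0; first by rewrite /sqnorm expr0n addr0 !mulr0.
  by move=> Wn0; have [<-] := mulfI Wn0 lm.
have lsum i : l i = \sum_j sqnorm (W i j).
  have /(congr1 (fun X : 'M_N => complex.Re (X i i))) := WW.
  rewrite [X in _ = complex.Re X]mxE eqxx [in RHS]mxE /= => <-.
  rewrite mxE Re_sum; apply: eq_bigr => j _.
  by rewrite [X in _ * X]mxE [X in _ * Num.conj X]mxE mulrC mul_conjC_sqnorm.
have msum j : m j = \sum_i sqnorm (W i j).
  have /(congr1 (fun X : 'M_N' => complex.Re (X j j))) := WW'.
  rewrite [X in _ = complex.Re X]mxE eqxx [in RHS]mxE /= => <-.
  rewrite mxE Re_sum; apply: eq_bigr => i _.
  by rewrite [X in X * _]mxE [X in Num.conj X * _]mxE mul_conjC_sqnorm.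
under eq_bigr do rewrite {1}lsum mulr_suml.
under [RHS]eq_bigr do rewrite {1}msum mulr_suml.
rewrite [RHS]exchange_big; apply: eq_bigr => i _; apply: eq_bigr => j _ /=.
have [->|wn0] := eqVneq (sqnorm (W i j)) 0; first by rewrite !mul0r.
by rewrite (mulIf wn0 (lW i j)).
Qed.

Lemma spectral_dec_conj n N (A : 'M[C]_n) (U : 'M_(n, N)) (l : 'I_N -> R) :
  spectral_dec A U l -> spectral_dec (map_mx Num.conj A) (map_mx Num.conj U) l.
Proof.
case=> UU UU' AE; split.
- by rewrite map_trmx -map_mxM UU map_mx1.
- by rewrite map_trmx -map_mxM UU' map_mx1.
rewrite AE !map_mxM map_trmx map_diag_mx; congr (_ *m diag_mx _ *m _).
by apply/rowP => k; rewrite !mxE; exact: conjc_real.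
Qed.

(** * Entropies of marginals given by kernels on finite types *)

Definition kernel_mx (K L : finType) (f : K -> L -> C) : 'M[C]_(#|K|, #|L|) :=
  \matrix_(i, j) f (enum_val i) (enum_val j).

(** The marginal on [K] of the vector with amplitudes [f k t]; [reduced phi g] is convertible to
    [gram (fun k t => phi (g k t))]. *)
Definition gram (K T : finType) (f : K -> T -> C) (k k' : K) : C :=
  \sum_t f k t * (f k' t)^*.

Lemma kernel_mxM (K L P : finType) (f : K -> L -> C) (g : L -> P -> C) :
  kernel_mx f *m kernel_mx g = kernel_mx (fun k p => \sum_t f k t * g t p).
Proof.
apply/matrixP => i j; rewrite !mxE.
under eq_bigr do rewrite !mxE.
by rewrite (sum_enum_val (fun t => f (enum_val i) t * g t (enum_val j))).
Qed.

Lemma kernel_mxC (K L : finType) (f : K -> L -> C) :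
  (kernel_mx f)^t* = kernel_mx (fun l k => (f k l)^*).
Proof. by apply/matrixP => i j; rewrite !mxE. Qed.

Lemma kernel_mx_gram (K T : finType) (f : K -> T -> C) :
  op_mx (gram f) = kernel_mx f *m (kernel_mx f)^t*.
Proof. by rewrite kernel_mxC kernel_mxM. Qed.

(** Replaces [xlnx] by l ln l, which agrees with it at 0 whatever value [ln] takes there. *)
Lemma vnS_gram (K T : finType) (f : K -> T -> C) :
  exists U : 'M_(#|K|, #|K|), exists l,
  [/\ spectral_dec (op_mx (gram f)) U l, forall k, 0 <= l k
    & vnS (gram f) = - \sum_k l k * ln (l k)].
Proof.
have [] := psd_spectral_dec (kernel_mx f); rewrite -kernel_mx_gram => dA l0.
exists ((spectralmx (op_mx (gram f)))^t*).
exists (fun k => complex.Re (spectral_diag (op_mx (gram f)) 0 k)); split=> //.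
rewrite /vnS; congr (- _); apply: eq_bigr => k _; rewrite /xlnx.
by case: eqVneq => // ->; rewrite mul0r.
Qed.

(** Complementary marginals of a pure state: the second is the entrywise conjugate of M^H M, and
    conjugation keeps a real spectrum. *)
Lemma vnS_gram_tr (K T : finType) (f : K -> T -> C) :
  vnS (gram f) = vnS (gram (fun t k => f k t)).
Proof.
have [U [l [dA l0 ->]]] := vnS_gram f.
have [V [m [dB m0 ->]]] := vnS_gram (fun t k => f k t).
congr (- _); rewrite kernel_mx_gram in dA.
apply: (schmidt_entropy dA (V := map_mx Num.conj V)).
suff -> : (kernel_mx f)^t* *m kernel_mx f =
    map_mx Num.conj (op_mx (gram (fun t k => f k t))) by exact: spectral_dec_conj.
rewrite kernel_mxC kernel_mxM; apply/matrixP => i j; rewrite !mxE rmorph_sum /=.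
by apply: eq_bigr => k _; rewrite rmorphM /=; congr (_ * _); rewrite -[LHS]conjcK.
Qed.

(** Reindexing the traced factor only permutes a sum; reindexing the kept one reduces to this by
    transposition. *)
Lemma vnS_gram_reindex (K K' T T' : finType) (h : K' -> K) (g : T' -> T)
    (f : K -> T -> C) :
  bijective h -> bijective g ->
  vnS (gram (fun k t => f (h k) (g t))) = vnS (gram f).
Proof.
move=> bh bg.
have E (L S S' : finType) (u : S' -> S) (e : L -> S -> C) :
    bijective u -> gram (fun k t => e k (u t)) = gram e.
  move=> bu; apply/funext => k; apply/funext => k'.
  by rewrite /gram [RHS](reindex u) //; exact: onW_bij.
rewrite (E _ _ _ g (fun k t => f (h k) t) bg) vnS_gram_tr.
by rewrite (E _ _ _ h (fun t k => f k t) bh) -vnS_gram_tr.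
Qed.

(** * Tensor factors given by bijections of index types *)

Definition basis_map_mx (K L : finType) (e : L -> K) : 'M[C]_(#|K|, #|L|) :=
  kernel_mx (fun k l => (k == e l)%:R).

Lemma basis_map_mxM (K L P : finType) (e : L -> K) (e' : P -> L) :
  basis_map_mx e *m basis_map_mx e' = basis_map_mx (e \o e').
Proof.
rewrite /basis_map_mx kernel_mxM; congr kernel_mx.
apply/funext => k; apply/funext => p; rewrite (bigD1 (e' p)) //= eqxx mulr1.
by rewrite big1 ?addr0 // => l /negPf ->; rewrite mulr0.
Qed.

Lemma basis_map_mxC_mul (K L P : finType) (e : L -> K) (f : K -> P -> C) :
  (basis_map_mx e)^t* *m kernel_mx f = kernel_mx (fun l p => f (e l) p).
Proof.
rewrite kernel_mxC kernel_mxM; congr kernel_mx.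
apply/funext => l; apply/funext => p; rewrite (bigD1 (e l)) //= eqxx.
rewrite big1 ?addr0 => [|k /negPf ->]; first by rewrite conjc1 mul1r.
by rewrite conjc0 mul0r.
Qed.

Lemma kernel_mx_mul_basis_map (K L P : finType) (e : L -> K) (f : P -> K -> C) :
  kernel_mx f *m basis_map_mx e = kernel_mx (fun p l => f p (e l)).
Proof.
rewrite kernel_mxM; congr kernel_mx.
apply/funext => p; apply/funext => l; rewrite (bigD1 (e l)) //= eqxx mulr1.
by rewrite big1 ?addr0 => [|k /negPf ->] //; rewrite mulr0.
Qed.

Section Factor.
Variables (K L Z : finType) (e : Z -> L -> K).
Hypothesis e_bij : bijective (fun y : L * Z => e y.2 y.1).
Let J z := basis_map_mx (e z).

(** Uses injectivity of [e_bij]; completeness below uses that every index is [e z l] for exactly one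
    pair. *)
Lemma basis_map_orth z z' : (J z)^t* *m J z' = (z == z')%:R%:M.
Proof.
rewrite basis_map_mxC_mul; apply/matrixP => i j; rewrite !mxE.
have -> : (e z (enum_val i) == e z' (enum_val j)) = (i == j) && (z == z').
  rewrite -(inj_eq enum_val_inj) -xpair_eqE.
  exact: (inj_eq (bij_inj e_bij) (_, z) (_, z')).
by case: (i == j); case: (z == z'); rewrite ?mulr1n ?mulr0n.
Qed.

Lemma basis_map_complete : lift_mx J 1%:M = 1%:M.
Proof.
apply/matrixP => i j; rewrite /lift_mx; under eq_bigr do rewrite mulmx1.
rewrite summxE.
under eq_bigr do rewrite /J kernel_mxC kernel_mxM mxE.
rewrite exchange_big /= pair_bigA /=.
case: e_bij => g ge eg.
rewrite (bigD1 (g (enum_val i))) //= (eg (enum_val i)) eqxx mul1r big1.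
  by rewrite addr0 (inj_eq enum_val_inj) eq_sym mxE; case: eqP; rewrite (conjc0, conjc1).
move=> y /eqP yi; rewrite (_ : (enum_val i == _) = false) ?mul0r //.
by apply/eqP => iE; apply: yi; rewrite iE ge.
Qed.

Lemma ptrace_kernel_mx (rho : K -> K -> C) :
  ptrace J (kernel_mx rho) = kernel_mx (fun l l' => \sum_z rho (e z l) (e z l')).
Proof.
rewrite /ptrace; under eq_bigr do rewrite basis_map_mxC_mul kernel_mx_mul_basis_map.
by apply/matrixP => i j; rewrite summxE mxE; apply: eq_bigr => z _; rewrite mxE.
Qed.

(** The traced index joins the purifying one, so marginals of marginals are again of the form
    [gram]. *)
Lemma ptrace_gram (T : finType) (f : K -> T -> C) :
  ptrace J (op_mx (gram f)) =
  op_mx (gram (fun l (zt : Z * T) => f (e zt.1 l) zt.2)).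
Proof.
rewrite [LHS]ptrace_kernel_mx; apply/matrixP => i j; rewrite !mxE /gram.
by rewrite (pair_bigA _ (fun z t => f (e z _) t * (f (e z _) t)^*)).
Qed.

End Factor.

(** * Strong subadditivity and coherent information *)

Lemma strong_subadditivity (X Y Z T : finType) (f : X -> Y -> Z -> T -> C) :
  vnS (gram (fun (k : X * Y * Z) t => f k.1.1 k.1.2 k.2 t)) +
  vnS (gram (fun y (t : X * Z * T) => f t.1.1 y t.1.2 t.2)) <=
  vnS (gram (fun (k : X * Y) (t : Z * T) => f k.1 k.2 t.1 t.2)) +
  vnS (gram (fun (k : Y * Z) (t : X * T) => f t.1 k.1 k.2 t.2)).
Proof.
pose F (k : X * Y * Z) t := f k.1.1 k.1.2 k.2 t.
pose eJ (z : Z) (k : X * Y) := (k, z).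
pose eN (x : X) (k : Y * Z) := (x, k.1, k.2).
pose eJ' (z : Z) (y : Y) := (y, z).
pose eN' (x : X) (y : Y) := (x, y).
have bJ : bijective (fun p : X * Y * Z => eJ p.2 p.1).
  by exists id => -[].
have bN : bijective (fun p : Y * Z * X => eN p.2 p.1).
  by exists (fun k => (k.1.2, k.2, k.1.1)) => [[[]]|[[]]].
have bN' : bijective (fun p : Y * X => eN' p.2 p.1).
  by exists (fun k => (k.2, k.1)) => -[].
have [U [l [dA l0 ->]]] := vnS_gram F.
have [V [l' [dA' l'0 ->]]] :=
  vnS_gram (fun (k : X * Y) (t : Z * T) => f k.1 k.2 t.1 t.2).
have [W [m [dB m0 ->]]] :=
  vnS_gram (fun (k : Y * Z) (t : X * T) => f t.1 k.1 k.2 t.2).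
(* Two successive partial traces produce the nesting X * (Z * T), so the traced index is
   reassociated to match. *)
have -> : vnS (gram (fun y (t : X * Z * T) => f t.1.1 y t.1.2 t.2)) =
    vnS (gram (fun y (t : X * (Z * T)) => f t.1 y t.2.1 t.2.2)).
  apply: (vnS_gram_reindex (h := id) (g := fun t : X * Z * T => (t.1.1, (t.1.2, t.2)))
    (fun y (t : X * (Z * T)) => f t.1 y t.2.1 t.2.2)); first by exists id.
  by exists (fun t => (t.1, t.2.1, t.2.2)) => [[[]]|[? []]].
have [S [m' [dB' m'0 ->]]] :=
  vnS_gram (fun y (t : X * (Z * T)) => f t.1 y t.2.1 t.2.2).
have := strong_subadditivity_mx (basis_map_orth bJ) (basis_map_complete bJ)
  (basis_map_orth bN) (basis_map_complete bN)
  (basis_map_orth bN') (basis_map_complete bN') (J' := fun z => basis_map_mx (eJ' z)).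
move=> /(_ _ _ _ _ _ _ _ U V W S l l' m m' dA).
rewrite !ptrace_gram.
move=> H.
suff : \sum_i l' i * ln (l' i) - \sum_i m' i * ln (m' i) <=
   \sum_i l i * ln (l i) - \sum_i m i * ln (m i) by lra.
apply: H => //.
- by move=> z x; rewrite !basis_map_mxM.
(* Both products send |y2 z2> to |x y2> if z2 = z and to 0 otherwise. *)
- move=> z x; rewrite [LHS]basis_map_mxC_mul kernel_mxC kernel_mxM; congr kernel_mx.
  apply/funext => -[x1 y1]; apply/funext => -[y2 z2] /=.
  rewrite (bigD1 y1) //= big1 ?addr0 => [|y]; rewrite /eN' /eJ' /eJ /eN /= !xpair_eqE.
    rewrite eqxx andbT [y2 == _]eq_sym [z2 == _]eq_sym.
    by case: (x1 == x); case: (y1 == y2); case: (z == z2);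
      rewrite ?(conjc0, conjc1, mul0r, mulr0, mulr1).
  by rewrite eq_sym => /negPf ->; rewrite andbF mul0r.
Qed.

End Entropy.

Lemma coherent_information_superadditive (R : realType)
    (dR dQ1 dE1 dQ2 dE2 : nat) (phi : Full dR dQ1 dE1 dQ2 dE2 -> R[i]) :
  Ic_B phi + Ic_C phi <= Ic_BC phi.
Proof.
rewrite /Ic_B /Ic_C /Ic_BC.
(* With E = E1E2, [B1] and [B2] give S(RQ1Q2) + S(Qi) <= S(RQi) + S(Q1Q2) for i = 1, 2, and by
   purity [B3] gives S(Q1) + S(Q2) <= S(RQ1) + S(RQ2). *)
pose B1 := strong_subadditivity (fun (r : 'I_dR) (q1 : 'I_dQ1) (q2 : 'I_dQ2)
  (t : 'I_dE1 * 'I_dE2) => phi (r, q1, t.1, q2, t.2)).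
pose B2 := strong_subadditivity (fun (r : 'I_dR) (q2 : 'I_dQ2) (q1 : 'I_dQ1)
  (t : 'I_dE1 * 'I_dE2) => phi (r, q1, t.1, q2, t.2)).
pose B3 := strong_subadditivity (fun (r : 'I_dR) (q1 : 'I_dQ1)
  (t : 'I_dE1 * 'I_dE2) (q2 : 'I_dQ2) => phi (r, q1, t.1, q2, t.2)).
(* The equalities up to [RQ2E] only permute and reassociate tensor factors. *)
have Q1E : vnS (gram (fun (q1 : 'I_dQ1) (t : 'I_dR * 'I_dQ2 * ('I_dE1 * 'I_dE2)) =>
    phi (t.1.1, q1, t.2.1, t.1.2, t.2.2))) = vnS (rho_Q1 phi).
  apply: (vnS_gram_reindex (h := id)
    (g := fun t : 'I_dR * 'I_dQ2 * ('I_dE1 * 'I_dE2) => (t.1.1, t.2.1, t.1.2, t.2.2))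
    (fun q1 t => phi (t.1.1.1, q1, t.1.1.2, t.1.2, t.2))); first by exists id.
  by exists (fun t => (t.1.1.1, t.1.2, (t.1.1.2, t.2))) => [[[? ?] [? ?]]|[[[? ?] ?] ?]].
have Q1E' : vnS (gram (fun (q1 : 'I_dQ1) (t : 'I_dR * ('I_dE1 * 'I_dE2) * 'I_dQ2) =>
    phi (t.1.1, q1, t.1.2.1, t.2, t.1.2.2))) = vnS (rho_Q1 phi).
  apply: (vnS_gram_reindex (h := id)
    (g := fun t : 'I_dR * ('I_dE1 * 'I_dE2) * 'I_dQ2 => (t.1.1, t.1.2.1, t.2, t.1.2.2))
    (fun q1 t => phi (t.1.1.1, q1, t.1.1.2, t.1.2, t.2))); first by exists id.
  by exists (fun t => (t.1.1.1, (t.1.1.2, t.2), t.1.2)) => [[[? [? ?]] ?]|[[[? ?] ?] ?]].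
have RQ1E : vnS (gram (fun (k : 'I_dR * 'I_dQ1) (t : 'I_dQ2 * ('I_dE1 * 'I_dE2)) =>
    phi (k.1, k.2, t.2.1, t.1, t.2.2))) = vnS (rho_RQ1 phi).
  apply: (vnS_gram_reindex (h := id)
    (g := fun t : 'I_dQ2 * ('I_dE1 * 'I_dE2) => (t.2.1, t.1, t.2.2))
    (fun k t => phi (k.1, k.2, t.1.1, t.1.2, t.2))); first by exists id.
  by exists (fun t => (t.1.2, (t.1.1, t.2))) => [[? [? ?]]|[[? ?] ?]].
have RQ1E' : vnS (gram (fun (k : 'I_dR * 'I_dQ1) (t : ('I_dE1 * 'I_dE2) * 'I_dQ2) =>
    phi (k.1, k.2, t.1.1, t.2, t.1.2))) = vnS (rho_RQ1 phi).
  apply: (vnS_gram_reindex (h := id)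
    (g := fun t : ('I_dE1 * 'I_dE2) * 'I_dQ2 => (t.1.1, t.2, t.1.2))
    (fun k t => phi (k.1, k.2, t.1.1, t.1.2, t.2))); first by exists id.
  by exists (fun t => ((t.1.1, t.2), t.1.2)) => [[[? ?] ?]|[[? ?] ?]].
have Q1Q2E : vnS (gram (fun (k : 'I_dQ1 * 'I_dQ2) (t : 'I_dR * ('I_dE1 * 'I_dE2)) =>
    phi (t.1, k.1, t.2.1, k.2, t.2.2))) = vnS (rho_Q1Q2 phi).
  apply: (vnS_gram_reindex (h := id)
    (g := fun t : 'I_dR * ('I_dE1 * 'I_dE2) => (t.1, t.2.1, t.2.2))
    (fun k t => phi (t.1.1, k.1, t.1.2, k.2, t.2))); first by exists id.
  by exists (fun t => (t.1.1, (t.1.2, t.2))) => [[? [? ?]]|[[? ?] ?]].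
have Q2Q1E : vnS (gram (fun (k : 'I_dQ2 * 'I_dQ1) (t : 'I_dR * ('I_dE1 * 'I_dE2)) =>
    phi (t.1, k.2, t.2.1, k.1, t.2.2))) = vnS (rho_Q1Q2 phi).
  apply: (vnS_gram_reindex (h := fun k : 'I_dQ2 * 'I_dQ1 => (k.2, k.1))
    (g := fun t : 'I_dR * ('I_dE1 * 'I_dE2) => (t.1, t.2.1, t.2.2))
    (fun k t => phi (t.1.1, k.1, t.1.2, k.2, t.2))).
    by exists (fun k => (k.2, k.1)) => -[].
  by exists (fun t => (t.1.1, (t.1.2, t.2))) => [[? [? ?]]|[[? ?] ?]].
have RQ2Q1E : vnS (gram (fun (k : 'I_dR * 'I_dQ2 * 'I_dQ1) (t : 'I_dE1 * 'I_dE2) =>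
    phi (k.1.1, k.2, t.1, k.1.2, t.2))) = vnS (rho_RQ1Q2 phi).
  apply: (vnS_gram_reindex (h := fun k : 'I_dR * 'I_dQ2 * 'I_dQ1 => (k.1.1, k.2, k.1.2))
    (g := id) (fun k t => phi (k.1.1, k.1.2, t.1, k.2, t.2))); last by exists id.
  by exists (fun k => (k.1.1, k.2, k.1.2)) => [[[? ?] ?]|[[? ?] ?]].
have Q2E : vnS (gram (fun (q2 : 'I_dQ2) (t : 'I_dR * 'I_dQ1 * ('I_dE1 * 'I_dE2)) =>
    phi (t.1.1, t.1.2, t.2.1, q2, t.2.2))) = vnS (rho_Q2 phi).
  apply: (vnS_gram_reindex (h := id)
    (g := fun t : 'I_dR * 'I_dQ1 * ('I_dE1 * 'I_dE2) => (t.1.1, t.1.2, t.2.1, t.2.2))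
    (fun q2 t => phi (t.1.1.1, t.1.1.2, t.1.2, q2, t.2))); first by exists id.
  by exists (fun t => (t.1.1.1, t.1.1.2, (t.1.2, t.2))) => [[[? ?] [? ?]]|[[[? ?] ?] ?]].
have RQ2E : vnS (gram (fun (k : 'I_dR * 'I_dQ2) (t : 'I_dQ1 * ('I_dE1 * 'I_dE2)) =>
    phi (k.1, t.1, t.2.1, k.2, t.2.2))) = vnS (rho_RQ2 phi).
  apply: (vnS_gram_reindex (h := id)
    (g := fun t : 'I_dQ1 * ('I_dE1 * 'I_dE2) => (t.1, t.2.1, t.2.2))
    (fun k t => phi (k.1, t.1.1, t.1.2, k.2, t.2))); first by exists id.
  by exists (fun t => (t.1.1, (t.1.2, t.2))) => [[? [? ?]]|[[? ?] ?]].
(* Purity: RQ1E1E2 is complementary to Q2, and Q1E1E2 to RQ2. *)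
have Q2dual : vnS (gram (fun (k : 'I_dR * 'I_dQ1 * ('I_dE1 * 'I_dE2)) (q2 : 'I_dQ2) =>
    phi (k.1.1, k.1.2, k.2.1, q2, k.2.2))) = vnS (rho_Q2 phi).
  by rewrite vnS_gram_tr.
have RQ2dual : vnS (gram (fun (k : 'I_dQ1 * ('I_dE1 * 'I_dE2)) (t : 'I_dR * 'I_dQ2) =>
    phi (t.1, k.1, k.2.1, t.2, k.2.2))) = vnS (rho_RQ2 phi).
  by rewrite vnS_gram_tr.
move: B1 B2 B3; rewrite Q1E RQ1E Q1Q2E RQ2Q1E Q2E RQ2E Q2Q1E Q2dual Q1E' RQ1E' RQ2dual.
rewrite -/(rho_RQ1Q2 phi).
lra.
Qed.

Unset Implicit Arguments. Set Strict Implicit.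

Theorem theorem2 (R : realType) (dR dQ1 dE1 dQ2 dE2 : nat)
  (psi : 'rV[R[i]]_(dR * dQ1 * dQ2)) (eps1 : 'rV[R[i]]_dE1)
  (eps2 : 'rV[R[i]]_dE2)
  (U1 : 'M[R[i]]_(dQ1 * dE1)) (U2 : 'M[R[i]]_(dQ2 * dE2))
  (chiQ1 chiE1 chiQ2 chiE2 HBob HCharlie PABC : R) :
  psi \is unitarymx -> eps1 \is unitarymx -> eps2 \is unitarymx ->
  U1 \is unitarymx -> U2 \is unitarymx ->
  let phi := final_state psi eps1 eps2 U1 U2 in
  HBob <= chiQ1 -> HCharlie <= chiQ2 ->
  chiQ1 - chiE1 = Ic_B phi ->
  chiQ2 - chiE2 = Ic_C phi ->
  Ic_BC phi <= PABC ->
  (HBob - chiE1) + (HCharlie - chiE2) <= PABC.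
Proof.
move=> _ _ _ _ _ phi HB HC chiB chiC IcP.
(* H_Bob - chi_E1 <= chi_Q1 - chi_E1 = Ic(A>B), likewise for Charlie, and the sum is at most
   Ic(A>BC). *)
have := coherent_information_superadditive phi; lra.
Qed.
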